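(* Let $n \geq 2$ and let $G = \bigcup_{i=1}^{n} A_i$ be a graph which is the union of $n$ complete graphs $A_1, A_2, \dots, A_n$, each having exactly $n$ vertices, such that every pair of distinct complete graphs $A_i, A_j$ has at most one common vertex. Suppose that for every $d$ with $2 \leq d \leq n$, every $A_i$ ($1 \leq i \leq n$) contains at most $\left\lceil \frac{n+d-1}{d} \right\rceil$ vertices of clique degree greater than or equal to $d$. Then $G$ is $n$-colorable, i.e. there is a proper vertex coloring of $G$ using $n$ colors.
   Context: For a vertex $v$ of $G$, the clique degree is $d^K(v) = |\{A_i : v \in V(A_i),\ 1 \leq i \leq n\}|$, the number of the complete graphs $A_i$ containing $v$. *)

(* Defs.v *)
From HB Require Import structures.
From mathcomp Require Import all_boot all_order all_algebra.

Set Implicit Arguments.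
Unset Strict Implicit.
Unset Printing Implicit Defensive.

Record sgraph := SGraph {
  vertex : finType;
  adj : rel vertex;
  adj_sym : symmetric adj;
  adj_irrefl : irreflexive adj
}.

(* A complete graph is represented by its vertex set S; this is its adjacency. *)
Definition complete_adj (T : finType) (S : {set T}) : rel T :=
  fun x y => [&& x \in S, y \in S & x != y].

(* The union of graphs has both the union of the vertex sets and the union of
   the edge sets, so every vertex of G lies in some A i. *)
Definition union_of_complete (G : sgraph) (n : nat)
    (A : 'I_n -> {set vertex G}) : Prop :=
  \bigcup_(i < n) A i = [set: vertex G] /\
  forall x y : vertex G, adj x y = [exists i : 'I_n, complete_adj (A i) x y].

(* Counts the distinct sets A i containing v, not the indices i; the two agree
   when A is injective. *)
Definition clique_degree (T : finType) (n : nat) (A : 'I_n -> {set T})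
    (v : T) : nat :=
  #|[set A i | i : 'I_n & v \in A i]|.

Definition colorable (G : sgraph) (k : nat) : Prop :=
  exists f : vertex G -> 'I_k, forall x y : vertex G, adj x y -> f x != f y.

(* Main.v *)
(** Colour the vertices greedily in order of decreasing clique degree.  Call a
    vertex to be coloured [e] a point lying on [d] lines (the cliques through
    it), let [P] be the set of points already coloured, and let [V j] be the set
    of lines meeting colour [j].  If for some colours [c], [j] every neighbour
    of [e] coloured [c] has no neighbour coloured [j], then all of them can be
    recoloured [j] at once, since they are pairwise non-adjacent, and [e] gets
    colour [c].  Otherwise fix [j]: on a line through [e] avoiding [j], the
    points that do see [j] do so along distinct lines of [V j] off [e], while
    for each [c] at least one line through [e] carrying [c] has a [c]-point that
    sees [j].  With [t] the ceiling of [(n - 1) / d], comparing these counts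
    forces [#|V j| > t] for every [j].  But the numbers [#|V j|] add up to the
    number of incidences between lines and coloured points, which is at most
    [n * (t + 1) - d]. *)

Require Import Defs.
From HB Require Import structures.
From mathcomp Require Import all_boot all_order all_algebra.
From mathcomp Require Import zify.

Set Implicit Arguments.
Unset Strict Implicit.
Unset Printing Implicit Defensive.

Import Order.TTheory GRing.Theory Num.Theory.

(** * Recolouring around a new point *)

Section Extend.

Variables (T I C : finType) (A : I -> {set T}).

Definition proper_on (P : {set T}) (f : T -> C) :=
  forall i x y, x \in P -> y \in P -> x \in A i -> y \in A i -> x != y ->
  f x != f y.

Definition linear_lines :=
  forall i j x y, x \in A i -> y \in A i -> x \in A j -> y \in A j -> x != y ->
  i = j.

Definition touched (P : {set T}) (f : T -> C) (j : C) : {set I} :=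
  [set i | j \in f @: (P :&: A i)].

Definition misses P f (x : T) (j : C) :=
  [forall i, (x \in A i) ==> (i \notin touched P f j)].

Hypothesis linA : linear_lines.
Variables (P : {set T}) (f : T -> C) (e : T).
Hypotheses (fP : proper_on P f) (eP : e \notin P).

Let V := touched P f.
Let E := [set i | e \in A i].
Let miss := misses P f.

Lemma touchedI i x : x \in P -> x \in A i -> i \in V (f x).
Proof. by move=> xP xi; rewrite inE; apply: imset_f; rewrite inE xP. Qed.

Lemma inj_line i : {in P :&: A i &, injective f}.
Proof.
move=> x y /setIP[xP xi] /setIP[yP yi] fxy.
apply/eqP; apply: contraTT isT => nxy.
by move: (fP xP yP xi yi nxy); rewrite fxy eqxx.
Qed.

(** The case [c = j] is allowed: a point of [P] on a line never misses its own colour, so the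
    condition then says that [c] is free at [e]. *)
Definition swappable c j :=
  [forall x in P, (f x == c) && [exists i in E, x \in A i] ==> miss x j].

Lemma proper_swap c j : swappable c j -> exists g, proper_on (e |: P) g.
Proof.
move=> /forall_inP sw.
pose R x := (f x == c) && [exists i in E, x \in A i].
exists (fun x => if x == e then c else if R x then j else f x).
have Rj x i y : x \in P -> R x -> x \in A i -> y \in P -> y \in A i -> f y != j.
  move=> xP Rx xi yP yi; have /implyP/(_ Rx)/forallP/(_ i) := sw x xP.
  by rewrite xi /=; apply: contraNneq => <-; apply: touchedI.
have ce i y : e \in A i -> y \in P -> y \in A i -> c != if R y then j else f y.
  move=> ei yP yi; case: ifPn => Ry.
    by have := Rj _ _ _ yP Ry yi yP yi; have /andP[/eqP-> _] := Ry.
  apply: contraNneq Ry => cE; rewrite /R -cE eqxx /=.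
  by apply/exists_inP; exists i; rewrite ?inE.
move=> i x y; rewrite !inE.
have [->|nxe] := eqVneq x e; have [->|nye] := eqVneq y e; rewrite ?eqxx //=.
- by move=> _ yP ei yi _; apply: ce ei yP yi.
- by move=> xP _ xi ei _; rewrite eq_sym; apply: ce ei xP xi.
move=> xP yP xi yi nxy; case: ifPn => Rx; case: ifPn => Ry.
- case/andP: Rx => /eqP fx _; case/andP: Ry => /eqP fy _.
  by move: (fP xP yP xi yi nxy); rewrite fx fy eqxx.
- by rewrite eq_sym; apply: Rj xP Rx xi yP yi.
- by apply: Rj yP Ry yi xP xi.
- exact: fP xP yP xi yi nxy.
Qed.

(** * Counting colours on the lines through the new point *)

Let W j c : {set I} :=
  [set i in E | [exists x in P :&: A i, (f x == c) && miss x j]].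

Lemma W_self j : W j j = set0.
Proof.
apply/setP=> i; rewrite !inE; apply/negbTE/nandP; right.
apply/exists_inPn => x /setIP[xP xi]; apply/nandP.
have [<-|] := eqVneq (f x) j; [right | by left].
by apply/forallPn; exists i; rewrite xi /= negbK; apply: touchedI.
Qed.

(** Some neighbour of [e] coloured [c] sees [j]. Its line is lost from [W j c], since by [inj_line]
    it carries no other point coloured [c]. *)
Lemma W_proper j c : ~~ swappable c j -> #|W j c| < #|V c :&: E|.
Proof.
move=> /forall_inPn[x xP]; rewrite negb_imply -andbA.
case/and3P => /eqP fx /exists_inP[i iE xi] nm.
apply: proper_card; apply/properP; split.
  apply/subsetP => k; rewrite inE => /andP[kE /exists_inP[y /setIP[yP yk]]].
  by case/andP => /eqP fy _; rewrite inE kE -fy touchedI.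
exists i; first by rewrite inE iE -fx touchedI.
rewrite inE iE /=; apply/exists_inPn => y yPi; apply/nandP.
have [fy|] := eqVneq (f y) c; [right | by left].
by rewrite (@inj_line i y x) // ?inE ?xP // fx.
Qed.

(** The coloured points of [A i] missing [j] have distinct colours and give the last term. Each
    other one lies on a line of [V j]. These lines are distinct and avoid [e], because a line
    sharing two points with [A i] is [i] itself, which is not in [V j]. *)
Lemma W_line j i : i \in E -> i \notin V j ->
  #|P :&: A i| + #|V j :&: E| <= #|V j| + #|[set c | i \in W j c]|.
Proof.
move=> iE iV; pose M := [set x | miss x j].
have -> : #|[set c | i \in W j c]| = #|P :&: A i :&: M|.
  rewrite -(card_in_imset (f := f)); last first.
    by move=> x y /setIP[xP _] /setIP[yP _]; apply: inj_line xP yP.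
  apply: eq_card => c; rewrite !inE; have := iE; rewrite inE => ->.
  apply/exists_inP/imsetP => [[x xP /andP[/eqP<- mx]]|[x]].
    by exists x; rewrite // in_setI xP inE.
  by case/setIP => xP; rewrite inE => mx ->; exists x; rewrite ?eqxx.
rewrite -(cardsID M (P :&: A i)) -(cardsID E (V j)).
suff : #|(P :&: A i) :\: M| <= #|V j :\: E| by lia.
(* The default [i] is never taken at a point that sees [j]. *)
pose h x := odflt i [pick k | (x \in A k) && (k \in V j)].
have hP x : x \in (P :&: A i) :\: M -> (x \in A (h x)) && (h x \in V j).
  case/setDP=> _; rewrite inE => /forallPn[k]; rewrite negb_imply negbK => xk.
  by rewrite /h; case: pickP => // /(_ k); rewrite xk.
have nh x : x \in (P :&: A i) :\: M -> i != h x.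
  by move=> /hP/andP[_ hV]; apply: contraNneq iV => ->.
rewrite -(card_in_imset (f := h)); last first.
  move=> x y xX yX hxy; apply/eqP; apply: contraTT (nh x xX) => nxy.
  rewrite negbK; apply/eqP.
  have /andP[xh _] := hP x xX; have /andP[yh _] := hP y yX.
  case/setDP: xX => /setIP[_ xi] _; case/setDP: yX => /setIP[_ yi] _.
  by apply: linA xi yi xh _ nxy; rewrite hxy.
apply: subset_leq_card; apply/subsetP => _ /imsetP[x xX ->].
have /andP[xh hV] := hP x xX; rewrite inE hV andbT.
apply: contra (nh x xX); rewrite inE => eh; apply/eqP.
case/setDP: xX => /setIP[xP xi] _; rewrite inE in iE.
by apply: linA xi iE xh eh _; apply: contraNneq eP => <-.
Qed.

Lemma double_count (J : {set I}) (B : C -> {set I}) :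
  \sum_c #|B c :&: J| = \sum_(i in J) #|[set c | i \in B c]|.
Proof.
under eq_bigr do rewrite -sum1_card.
under [RHS]eq_bigr do rewrite -sum1_card.
rewrite (exchange_big_dep (mem J)) /=; last by move=> c i _ /setIP[].
by apply: eq_bigr => i iJ; apply: eq_bigl => c; rewrite !inE iJ andbT.
Qed.

Lemma sum_touched J : \sum_c #|V c :&: J| = \sum_(i in J) #|P :&: A i|.
Proof.
rewrite double_count; apply: eq_bigr => i _.
rewrite -(card_in_imset (@inj_line i)); apply: eq_card => c.
by rewrite !inE.
Qed.

(** The hypotheses pull [t] in opposite directions: when [e] lies on a line, the second caps it at
    the ceiling of [(#|C| - 1) / #|E|], while the third needs it large. *)
Lemma extend_coloring t : #|I| <= #|C| -> #|E| * t + 2 <= #|C| + #|E| ->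
  (forall i, #|(e |: P) :&: A i| <= t.+1) ->
  exists g, proper_on (e |: P) g.
Proof.
move=> leIC hE hA.
have [/existsP[c /existsP[j]]|/existsPn nsw] :=
  boolP [exists c, exists j, swappable c j]; first exact: proper_swap.
exfalso.
have ltW c j : #|W j c| < #|V c :&: E|.
  by apply: W_proper; have /existsPn := nsw c; apply.
(* A line through [e] spends one of its [t.+1] places on [e]. *)
have hline i : #|P :&: A i| + (i \in E) <= t.+1.
  rewrite (leq_trans _ (hA i)) // addnC.
  have [|_] := boolP (i \in E); last first.
    by apply: subset_leq_card; apply: setSI; apply: subsetUr.
  rewrite inE => ei.
  rewrite (cardsD1 e ((e |: P) :&: A i)) !inE eqxx ei /= leq_add2l.
  apply: subset_leq_card.
  apply/subsetP => x /setIP[xP xi]; rewrite !inE xP xi orbT !andbT.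
  by apply: contraNneq eP => <-.
have hV j : t < #|V j|.
  have hM := sum_touched E.
  have hW := double_count E (W j).
  (* Colour [j] loses all of [V j :&: E], as [W j j] is empty; each of the other [#|C| - 1] colours
     loses at least one line. *)
  have hW1 : \sum_c #|W j c :&: E| + #|C| + #|V j :&: E|
             <= \sum_c #|V c :&: E| + 1.
    have -> : #|C| = (\sum_(c | c != j) 1).+1.
      by rewrite -sum1_card (bigD1 j).
    rewrite (bigD1 j) //= W_self set0I cards0 add0n.
    rewrite [X in _ <= X + _](bigD1 j) //=.
    have : \sum_(c | c != j) (#|W j c :&: E| + 1) <=
        \sum_(c | c != j) #|V c :&: E|.
      apply: leq_sum => c _; rewrite addn1; apply: leq_ltn_trans (ltW c j).
      by apply: subset_leq_card; apply: subsetIl.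
    by rewrite big_split /=; lia.
  (* Lines of [E] in [V j] are bounded through [hline], the others through [W_line]. *)
  have hE1 : \sum_(i in E) #|P :&: A i| + #|E :\: V j| * #|V j :&: E| <=
      #|V j :&: E| * t + #|E :\: V j| * #|V j|
      + \sum_(i in E) #|[set c | i \in W j c]|.
    have sE (F : I -> nat) : \sum_(i in E) F i =
        \sum_(i in V j :&: E) F i + \sum_(i in E :\: V j) F i.
      rewrite (big_setID (V j)) /=; congr (_ + _); apply: eq_bigl => i.
      by rewrite setIC.
    rewrite !sE -!sum_nat_const.
    have h1 : \sum_(i in V j :&: E) #|P :&: A i| <= \sum_(i in V j :&: E) t.
      apply: leq_sum => i /setIP[_ iE]; have := hline i; rewrite iE; lia.
    have h2 : \sum_(i in E :\: V j) (#|P :&: A i| + #|V j :&: E|) <=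
        \sum_(i in E :\: V j) (#|V j| + #|[set c | i \in W j c]|).
      by apply: leq_sum => i /setDP[iE iV]; apply: W_line.
    by move: h2; rewrite !big_split /=; lia.
  have hm : 0 < #|V j :&: E| by apply: leq_ltn_trans (ltW j j).
  have hd := cardsID (V j) E; rewrite [E :&: _]setIC in hd.
  rewrite ltnNge; apply/negP => le_Vt.
  move: hM hW hW1 hE1 hm hd hE le_Vt.
  move: (\sum_c _) (\sum_c _) (\sum_(i in E) _) (\sum_(i in E) _).
  move: #|V j :&: E| #|E :\: V j| #|V j| #|E| #|C| => m p v d n s1 s2 s3 s4.
  move=> -> -> h1 h2 m0 <- h3 hv.
  (* With [v <= t], combining [h1], [h2] and [h3] gives [p * m < p], contrary to [m0]. *)
  have : p * v <= p * t by rewrite leq_mul2l hv orbT.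
  have : p <= p * m by rewrite leq_pmulr.
  by rewrite mulnDl in h3; lia.
have [j _] : exists j : C, true.
  case: (pickP C) => [j|C0]; first by exists j.
  have := leq_trans (max_card E) leIC; move: hE; rewrite (eq_card0 C0); lia.
have E0 : 0 < #|E|.
  rewrite (leq_trans (leq_ltn_trans _ (ltW j j))) //.
  by rewrite subset_leq_card ?subsetIr.
have hC : #|C| * t.+1 <= \sum_c #|V c|.
  by rewrite -sum_nat_const; apply: leq_sum => c _; apply: hV.
have hI : \sum_i #|P :&: A i| + #|E| <= #|I| * t.+1.
  rewrite -sum_nat_const -sum1_card [X in _ + X]big_mkcond -big_split /=.
  by apply: leq_sum => i _; apply: hline.
have : #|I| * t.+1 <= #|C| * t.+1 by rewrite leq_mul2r leIC orbT.
have sV : \sum_c #|V c| = \sum_i #|P :&: A i|.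
  rewrite -(eq_bigl _ _ (@in_setT I)) -sum_touched.
  by apply: eq_bigr => c _; rewrite setIT.
lia.
Qed.

End Extend.

(** * Greedy colouring by decreasing clique degree *)

Theorem theorem2 (n : nat) (G : sgraph) (A : 'I_n -> {set vertex G})
  (hn : 2 <= n)
  (hG : union_of_complete A)
  (hcard : forall i : 'I_n, #|A i| = n)
  (hmeet : forall i j : 'I_n, i != j -> #|A i :&: A j| <= 1)
  (hdeg : forall d : nat, 2 <= d <= n -> forall i : 'I_n,
     (#|[set v in A i | (d <= clique_degree A v)%N]|%:Z
        <= Num.ceil ((n%:R + d%:R - 1) / d%:R : rat))%R) :
  colorable G n.
Proof.
case: hG => cover_A adjA.
have injA : injective A.
  move=> i j Aij; apply/eqP; apply: contraTT hn => /hmeet.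
  by rewrite Aij setIid hcard -ltnNge.
have degE x : clique_degree A x = #|[set i | x \in A i]|.
  by rewrite /clique_degree card_imset.
have linA : linear_lines A.
  move=> i j x y xi yi xj yj nxy; apply/eqP; apply: contraTT nxy => /hmeet.
  rewrite negbK => /card_le1_eqP h; apply/eqP; apply: h; rewrite inE ?xi ?yi //.
(* Invariant of the greedy order: when [e] is added, all coloured points have clique degree at least
   that of [e], so [hdeg] at this degree limits them on every line. *)
pose up (P : {set vertex G}) :=
  forall x y, x \in P -> y \notin P -> clique_degree A y <= clique_degree A x.
have hP m : m <= #|vertex G| ->
    exists2 P : {set vertex G}, #|P| = m /\ up P &
      exists f : vertex G -> 'I_n, proper_on A P f.
  elim: m => [_|m IHm ltm].
    exists set0; first by split; [rewrite cards0 | move=> x y; rewrite inE].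
    by exists (fun=> Ordinal (ltnW hn)) => i x y; rewrite inE.
  have [P [cP uP] [f fP]] := IHm (ltnW ltm).
  have [e0 e0P] : exists x, x \in ~: P.
    by apply/set0Pn; rewrite -card_gt0 cardsCs setCK cP subn_gt0.
  case: (arg_maxnP (clique_degree A) (e0P : [in ~: P] e0)) => e /= eC emax.
  have eP : e \notin P by rewrite inE in eC.
  exists (e |: P); first split.
  - by rewrite cardsU1 eP cP.
  - move=> x y; rewrite !inE negb_or => /orP[/eqP->|xP] /andP[_ yP].
      by apply: emax; rewrite inE.
    exact: uP xP yP.
  pose d := clique_degree A e.
  have d0 : 0 < d.
    have : e \in \bigcup_(i < n) A i by rewrite cover_A inE.
    case/bigcupP => i _ ei; rewrite /d degE card_gt0.
    by apply/set0Pn; exists i; rewrite inE.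
  have dn : d <= n by rewrite /d degE -[n in _ <= n]card_ord; apply: max_card.
  (* This is the ceiling of (n - 1) / d. *)
  pose t := (n + d - 2) %/ d.
  have td : t * d <= n + d - 2 by apply: leq_divM.
  have dt : n + d - 2 < t.+1 * d by apply: ltn_ceil.
  apply: (extend_coloring linA fP eP (t := t)).
  - by rewrite card_ord.
  - by rewrite card_ord -degE -/d; lia.
  move=> i.
  have sub : (e |: P) :&: A i \subset [set v in A i | d <= clique_degree A v].
    apply/subsetP => x; rewrite !inE => /andP[/orP[/eqP->|xP] ->] //=.
    exact: uP xP eP.
  apply: leq_trans (subset_leq_card sub) _.
  (* [hdeg] starts at degree 2; for [d = 1] the bound [t.+1 = n] is the size of a clique. *)
  have [d1|d2] := leqP d 1.
    have dE : d = 1 by lia.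
    have -> : t = n.-1 by rewrite /t dE divn1; lia.
    rewrite prednK; last by lia.
    apply: leq_trans (_ : #|A i| <= n); last by rewrite hcard.
    apply: subset_leq_card.
    by apply/subsetP => x; rewrite inE => /andP[].
  have := hdeg d; rewrite d2 dn => /(_ isT i) /le_trans h.
  rewrite -lez_nat; apply: h.
  (* The ceiling is at most [t.+1] because [n + d - 1 <= t.+1 * d], which is [dt]. *)
  rewrite real_ceil_le_int ?num_real // ler_pdivrMr ?ltr0n //.
  rewrite pmulrn -natrM lerBlDr -natrD natr1 ler_nat.
  lia.
have [P [cP _] [f fP]] := hP _ (leqnn _).
have PT x : x \in P.
  by have /eqP -> : P == setT by rewrite eqEcard subsetT cardsT cP /=.
exists f => x y; rewrite adjA => /existsP[i /and3P[xi yi nxy]].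
exact: fP (PT x) (PT y) xi yi nxy.
Qed.
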